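(* Let $(X,\rho)$ be a geometrically doubling quasi-metric space with quasi-metric constant $A_0\ge 1$. Suppose that constants $0<c_0\le C_0<\infty$ and $\delta\in(0,1)$ satisfy $12A_0^3C_0\delta\le c_0$. Let $k_0\in\mathbb{Z}$ be a preassigned number. Given, for every $k\in\mathbb{Z}$, a set of points $\{z^k_\alpha\}_{\alpha\in\mathscr{A}_k}\subseteq X$ such that $$\rho(z^k_\alpha,z^k_\beta)\ge c_0\delta^k\quad(\alpha\ne\beta),\qquad \min_\alpha\rho(x,z^k_\alpha)<C_0\delta^k\quad\text{for all }x\in X,$$ one can construct families of sets $\tilde Q^k_\alpha\subseteq Q^k_\alpha\subseteq\bar Q^k_\alpha$ ($k\in\mathbb{Z}$, $\alpha\in\mathscr{A}_k$), called open, half-open and closed dyadic cubes, such that: (1) $\tilde Q^k_\alpha$ and $\bar Q^k_\alpha$ are the interior and the closure of $Q^k_\alpha$, respectively; (2) if $\ell\ge k$, then either $Q^\ell_\beta\subseteq Q^k_\alpha$ or $Q^k_\alpha\cap Q^\ell_\beta=\varnothing$; (3) for every $k\in\mathbb{Z}$, $X=\bigcup_{\alpha}Q^k_\alpha$ and this union is disjoint; (4) $B(z^k_\alpha,c_1\delta^k)\subseteq Q^k_\alpha\subseteq B(z^k_\alpha,C_1\delta^k)=:B(Q^k_\alpha)$, where $c_1:=(3A_0^2)^{-1}c_0$ and $C_1:=2A_0C_0$; (5) if $k\le\ell$ and $Q^\ell_\beta\subseteq Q^k_\alpha$, then $B(Q^\ell_\beta)\subseteq B(Q^k_\alpha)$.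 Moreover, the open and closed cubes $\tilde Q^k_\alpha$ and $\bar Q^k_\alpha$ depend only on the points $z^\ell_\beta$ with $\ell\ge k$, and the half-open cubes $Q^k_\alpha$ depend only on the points $z^\ell_\beta$ with $\ell\ge\min(k,k_0)$. (That is, the assignment of the cubes to the given point families can be made so that, if two admissible point families have the same index sets and the same points on all levels $\ell\ge k$, respectively on all levels $\ell\ge\min(k,k_0)$, then the resulting open and closed cubes, respectively half-open cubes, of level $k$ coincide.)
   Context: A quasi-metric $\rho$ on $X$ satisfies the axioms of a metric except that the triangle inequality is weakened to $\rho(x,y)\le A_0(\rho(x,z)+\rho(z,y))$ with a constant $A_0\ge1$. Balls are $B(x,r):=\{y\in X:\rho(y,x)<r\}$. Geometric doubling means: there is $A_1\in\mathbb{N}$ such that every ball $B(x,r)$ ($x\in X$, $r>0$) can be covered by at most $A_1$ balls of radius $r/2$. A set $\Omega\subseteq X$ is open if for every $x\in\Omega$ there is $\varepsilon>0$ with $B(x,\varepsilon)\subseteq\Omega$; closed sets are complements of open sets; interior and closure refer to this topology (balls need not be open). *)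

(* Defs.v *)
From HB Require Import structures.
From mathcomp Require Import all_boot all_order all_algebra.
From mathcomp Require Import all_classical all_reals all_analysis.

Set Implicit Arguments.
Unset Strict Implicit.
Unset Printing Implicit Defensive.

Import Order.TTheory GRing.Theory Num.Theory.

Local Open Scope classical_set_scope.
Local Open Scope ring_scope.

Definition quasi_metric (R : realType) (X : Type) (A0 : R)
    (rho : X -> X -> R) : Prop :=
  [/\ forall x y, 0 <= rho x y,
      forall x y, rho x y = 0 <-> x = y,
      forall x y, rho x y = rho y x &
      forall x y z, rho x y <= A0 * (rho x z + rho z y)].

Definition qball (R : realType) (X : Type) (rho : X -> X -> R)
    (x : X) (r : R) : set X :=
  [set y | rho y x < r].

(* [D] is the set of centres of the covering balls. *)
Definition geometrically_doubling (R : realType) (X : Type)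
    (rho : X -> X -> R) : Prop :=
  exists A1 : nat, forall (x : X) (r : R), 0 < r ->
    exists D : set X, (D #<= `I_A1)%card /\
      qball rho x r `<=` \bigcup_(y in D) qball rho y (r / 2).

Definition qopen (R : realType) (X : Type) (rho : X -> X -> R)
    (U : set X) : Prop :=
  forall x, U x -> exists2 e : R, 0 < e & qball rho x e `<=` U.

(* [qspace rho] is a copy of the carrier [X] whose open sets are those of
   [qopen rho]; [qball rho x r] need not be open, nor a neighbourhood of [x],
   for an arbitrary [rho]. *)
Definition qspace (R : realType) (X : Type) (rho : X -> X -> R) : Type := X.

Section qspace_topology.
Context (R : realType) (X : Type) (rho : X -> X -> R).

HB.instance Definition _ := gen_eqMixin (qspace rho).
HB.instance Definition _ := gen_choiceMixin (qspace rho).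

Lemma qopenT : qopen rho setT.
Proof. by move=> x _; exists 1. Qed.

Lemma qopenI : setI_closed (qopen rho).
Proof.
move=> U V oU oV x [Ux Vx].
have [e e0 eU] := oU _ Ux; have [d d0 dV] := oV _ Vx.
exists (Num.min e d); first by rewrite lt_min e0.
by move=> y; rewrite /qball /= lt_min => /andP[ye yd]; split;
  [exact: eU|exact: dV].
Qed.

Lemma qopen_bigU (J : Type) (f : J -> set X) :
  (forall i, qopen rho (f i)) -> qopen rho (\bigcup_i f i).
Proof.
move=> of_ x [i _ fix_]; have [e e0 ef] := of_ _ _ fix_.
by exists e => // y /ef fiy; exists i.
Qed.

HB.instance Definition _ :=
  isOpenTopological.Build (qspace rho) qopenT qopenI qopen_bigU.

Lemma open_qspaceE : (open : set (set (qspace rho))) = qopen rho.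
Proof. by []. Qed.

End qspace_topology.

Definition qinterior (R : realType) (X : Type) (rho : X -> X -> R)
    (U : set X) : set X :=
  interior (U : set (qspace rho)).

Definition qclosure (R : realType) (X : Type) (rho : X -> X -> R)
    (U : set X) : set X :=
  closure (U : set (qspace rho)).

(* A family of points {z^k_a : a in A_k}, k in Z, is a pair [(A, z)]: the index
   sets [A k] are subsets of one type [I], which makes the index sets of two
   families comparable, and [z k a] is irrelevant for [a] outside [A k]. *)
Definition admissible_points (R : realType) (X : Type) (rho : X -> X -> R)
    (c0 C0 delta : R) (I : Type) (A : int -> set I) (z : int -> I -> X) :
    Prop :=
  (forall k a b, A k a -> A k b -> a <> b ->
     c0 * delta ^ k <= rho (z k a) (z k b)) /\
  (forall k x, exists a,
     [/\ A k a,
         forall b, A k b -> rho x (z k a) <= rho x (z k b) &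
         rho x (z k a) < C0 * delta ^ k]).

Definition same_points_from (X I : Type) (m : int)
    (A A' : int -> set I) (z z' : int -> I -> X) : Prop :=
  forall l, m <= l -> A l = A' l /\ (forall a, A l a -> z l a = z' l a).

(* Main.v *)
Require Import Defs.
From mathcomp Require Import all_boot all_order all_algebra.
From mathcomp Require Import all_classical all_reals all_analysis.
From mathcomp Require Import ring lra zify.

Import Order.TTheory GRing.Theory Num.Theory.
Import numFieldNormedType.Exports.

Local Open Scope classical_set_scope.
Local Open Scope ring_scope.

(** The points of all levels are organised into a tree: the parent of a point
    of level [k + 1] is a nearest point of level [k].  Since [delta] is small, a
    descendant of [z k a] stays within a fixed multiple of [delta ^ k] of
    [z k a] (lemma [ancestor_dist]).  The closed cube of [z k a] is the set of
    limits of its arbitrarily deep descendants.  Three facts carry the proof.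

    - Geometric doubling makes only finitely many points of level [k] relevant
      near a given [x]; so if descendants with ancestors in a set [T] approach
      [x], infinitely many of them share one ancestor in [T], and [x] is in its
      limit cube ([limit_cube_accumulation]).  Hence limit cubes cover the
      space, every point of a limit cube lies in the limit cube of a child, and
      the union of all limit cubes of a level but one is closed.

    - The limit cube of [a] lies in the ball of radius [2 * A0 * C0 * delta ^ k]
      around [z k a] ([limit_cube_sub_ball]).  Applied to children, this shows
      that a ball of radius [c0 / (3 * A0 ^ 2) * delta ^ k] around [z k a] meets
      no other limit cube of level [k], because the child responsible for a
      meeting point would be close enough to [z k a] to have [a] as its parent
      ([inner_ball_limit_cube]).

    - Limit cubes of one level overlap, so each point [x] selects one limit
      cube per level: an arbitrary one containing [x] at level [k0], then
      children of the previous choice at higher levels and ancestors of the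
      level [k0] choice at lower levels.  This address is compatible with
      parents ([parent_address]), so the half-open cubes, its level sets, form
      nested partitions whatever the selections were.

    The interior and closure of a half-open cube do not depend on these
    selections.  Deep descendants of [z k a] are centres of small half-open
    cubes contained in that of [a], so this cube is dense in its limit cube
    ([half_open_cube_dense]).  Its closure is therefore the limit cube of [a],
    and its interior consists of the points that belong to no other limit cube
    of level [k].

    Every selection is made by one function [pick] from sets of indices to
    indices, applied to a set determined by the points of the relevant levels;
    equal points then give equal cubes. *)

(** * Geometric decay, integer levels and a pigeonhole principle *)

Lemma exprn_lt_eventually {R : realType} {r e : R} :
  0 < r -> r < 1 -> 0 < e -> exists N, forall n, (N <= n)%N -> r ^+ n < e.
Proof.
move=> r0 r1 e0.
have /cvgr0_norm_lt /(_ _ e0) [N _ Ne] :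
    (GRing.exp r : nat -> R) @ \oo --> (0 : R).
  by apply: cvg_expr; rewrite ger0_norm // ltW.
exists N => n Nn; have := Ne n Nn.
by rewrite ger0_norm // exprn_ge0 // ltW.
Qed.

Lemma finite_pigeonhole (I : Type) (F : set I) (P : I -> nat -> Prop) :
  finite_set F ->
  (forall a m n, (m <= n)%N -> P a n -> P a m) ->
  (forall n, exists2 a, F a & P a n) ->
  exists2 a, F a & forall n, P a n.
Proof.
move=> finF anti exP; apply: contrapT => noP.
have /choice[N NP] : forall a, exists n, F a -> ~ P a n.
  move=> a; apply: contrapT => Na; apply: noP; exists a => [|n].
    by apply: contrapT => nFa; apply: Na; exists 0%N.
  by apply: contrapT => nPan; apply: Na; exists n.
have /finite_seqP[s Ns] := finite_image N finF.
have [a Fa /anti Pa] := exP (\max_(i <- s) i)%N.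
apply: (NP a Fa); apply: Pa.
have : (N a) \in s by have : (N @` F) (N a) by [exists a]; rewrite Ns.
by move=> ins; apply: (leq_bigmax_seq _ ins).
Qed.

Lemma int_succA (k : int) (n : nat) : k + n.+1%:Z = k + 1 + n%:Z.
Proof. by lia. Qed.

Lemma int_succ (k : int) (n : nat) : k + n.+1%:Z = k + n%:Z + 1.
Proof. by lia. Qed.

Lemma int_le_add (k : int) (n : nat) : k <= k + n%:Z.
Proof. by rewrite lerDl. Qed.

Lemma int_split (k0 k : int) :
  (exists n : nat, k = k0 + n%:Z) \/ (exists n : nat, k = k0 - n.+1%:Z).
Proof.
case E : (k - k0) => [n|n]; [left|right]; exists n; lia.
Qed.

(** * Quasi-metric spaces *)

Section quasi_metric_facts.
Context {R : realType} {X : Type} {rho : X -> X -> R} {A0 : R}.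
Hypotheses (hA0 : 1 <= A0) (hrho : quasi_metric A0 rho).

Lemma qmetricxx x : rho x x = 0.
Proof. by case: hrho => _ h _ _; apply/h. Qed.

Lemma qmetricC x y : rho x y = rho y x.
Proof. by case: hrho. Qed.

Lemma qmetric_triangle z x y : rho x y <= A0 * (rho x z + rho z y).
Proof. by case: hrho. Qed.

Lemma doubling_cover_finite : geometrically_doubling rho ->
  forall n (x : X) (r : R), 0 < r ->
  exists2 D : set X, finite_set D &
    qball rho x r `<=` \bigcup_(y in D) qball rho y (r / 2 ^+ n).
Proof.
move=> [A1 dbl]; elim=> [|n IH] x r r0.
  exists [set x]; first exact: finite_set1.
  by move=> y xy; exists x => //; rewrite expr0 divr1.
have [D finD cov] := IH x r r0.
have rn0 : 0 < r / 2 ^+ n by rewrite divr_gt0// exprn_gt0.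
have [E EP] := choice (fun y => dbl y _ rn0).
exists (\bigcup_(y in D) E y).
  apply: bigcup_finite => // y _; apply/finite_set_leP; exists A1.
  by have [] := EP y.
move=> y /cov[d Dd /(proj2 (EP d))[e Ee ye]].
exists e; first by exists d.
by move: ye; rewrite exprSr invfM mulrA.
Qed.

(** Halve the radius until a covering ball is too small to contain two
    separated points. *)
Lemma separated_ball_finite {I : Type} {S : set I} {f : I -> X} {c r : R} {x} :
  geometrically_doubling rho -> 0 < c ->
  (forall a b, S a -> S b -> a <> b -> c <= rho (f a) (f b)) ->
  finite_set (S `&` [set a | rho (f a) x < r]).
Proof.
move=> dbl c0 sep; have A00 : 0 < A0 by exact: lt_le_trans ltr01 hA0.
have m0 : 0 < Num.max r 1 by rewrite lt_max ltr01 orbT.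
have [n0 /(_ n0 (leqnn _)) hn] := @exprn_lt_eventually R 2^-1
  (c / (2 * A0) / Num.max r 1) ltac:(lra) ltac:(lra)
  ltac:(by rewrite !divr_gt0 ?mulr_gt0).
have [D finD cov] := doubling_cover_finite dbl n0 x _ m0.
apply: (@sub_finite_set _ _ (\bigcup_(d in D)
  (S `&` [set a | rho (f a) d < Num.max r 1 / 2 ^+ n0]))).
  move=> a [Sa ar]; have [|d Dd ad] := cov (f a).
    by rewrite /qball /= lt_max ar.
  by exists d.
apply: bigcup_finite => // d Dd.
(* two separated points cannot share a ball of radius at most [c / (2 * A0)] *)
have [noa|/existsNP[a /contrapT aB]] := pselect (forall a,
    ~ (S `&` [set a | rho (f a) d < Num.max r 1 / 2 ^+ n0]) a).
  by rewrite (_ : _ `&` _ = set0) ?finite_set0 // -subset0 => a /noa.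
apply: (@sub_finite_set _ _ [set a]); last exact: finite_set1.
move=> b [Sb bd]; case: aB => Sa ad; apply: contrapT => /nesym ab.
have := sep a b Sa Sb ab; have := qmetric_triangle d (f a) (f b).
rewrite (qmetricC d); move: hn ad bd => /=.
rewrite exprVn ltr_pdivlMr // ltr_pdivlMr ?mulr_gt0// (mulrC (2 ^- n0)).
by set t := _ / _ => tc ad bd; nra.
Qed.

(** The interior is identified as a largest open subset, and the closure below
    as a closed superset in which the set is ball-dense; neither requires balls
    to be open or to be neighbourhoods of their centres. *)
Lemma qinterior_unique (U V : set X) : qopen rho V -> V `<=` U ->
  (forall W, qopen rho W -> W `<=` U -> W `<=` V) -> V = qinterior rho U.
Proof.
move=> oV VU maxV; rewrite /qinterior eqEsubset; split.
  by rewrite -(@open_subsetE (qspace rho)).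
apply: maxV; last exact: (@interior_subset (qspace rho)).
exact: (@open_interior (qspace rho)).
Qed.

Lemma qclosure_unique (U V : set X) : qopen rho (~` V) -> U `<=` V ->
  (forall x, V x -> forall e, 0 < e -> U `&` qball rho x e !=set0) ->
  V = qclosure rho U.
Proof.
move=> oV UV dense; rewrite /qclosure eqEsubset; split.
  move=> x Vx; rewrite (@closureEonbhs (qspace rho)) => A W UA [oW Wx].
  have [e e0 eW] := oW x Wx.
  have [y [Uy ye]] := dense x Vx e e0.
  by exists y; split; [exact: UA|exact: eW].
rewrite [X in _ `<=` X](_ : V = closure (V : set (qspace rho))).
  exact: (@closureS (qspace rho)).
apply: (proj1 (@closure_id (qspace rho) V)); rewrite -[V]setCK.
exact: (@open_closedC (qspace rho)).
Qed.

End quasi_metric_facts.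

(** * The tree of points *)

Section tree_of_points.
Context {R : realType} {X : Type} (rho : X -> X -> R) (delta : R) (k0 : int)
  {I : Type} (pick : set I -> I).

Section one_family.
Variables (A : int -> set I) (z : int -> I -> X).

(** [pick] is a fixed choice function on sets of indices; it sees a family only
    through the set it is applied to, which makes the construction local. *)
Definition nearest (k : int) (x : X) : I :=
  pick [set a | A k a /\ forall b, A k b -> rho x (z k a) <= rho x (z k b)].

Definition parent (k : int) (b : I) : I := nearest k (z (k + 1) b).

(** [b] is read as an index of level [k + n]. *)
Fixpoint ancestor (n : nat) (k : int) (b : I) : I :=
  if n is m.+1 then parent k (ancestor m (k + 1) b) else b.

(** Only approximation by arbitrarily deep descendants counts, not by [z k a]
    itself: a point then passes to the limit cube of a child without
    distinguishing whether it is an isolated centre. *)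
Definition limit_cube (k : int) (a : I) : set X := [set x | forall N : nat,
  exists n b, [/\ (N <= n)%N, A (k + n%:Z) b, ancestor n k b = a &
                  rho x (z (k + n%:Z) b) < delta ^+ N]].

Definition open_cube (k : int) (a : I) : set X :=
  [set x | forall b, A k b -> limit_cube k b x -> b = a].

Fixpoint address_up (n : nat) (x : X) : I :=
  if n is m.+1 then
    pick [set b | [/\ A (k0 + m%:Z + 1) b,
                      parent (k0 + m%:Z) b = address_up m x &
                      limit_cube (k0 + m%:Z + 1) b x]]
  else pick [set a | A k0 a /\ limit_cube k0 a x].

(** The index, among the level [k] limit cubes containing [x], that [x] is
    assigned to. *)
Definition address (k : int) (x : X) : I :=
  match k - k0 with
  | Posz n => address_up n x
  | Negz n => ancestor n.+1 k (address_up 0 x)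
  end.

Definition half_open_cube (k : int) (a : I) : set X :=
  [set x | address k x = a].

End one_family.
End tree_of_points.

Section cubes_of_one_family.
Context {R : realType} {X : Type} {rho : X -> X -> R} {A0 c0 C0 delta : R}
  {k0 : int} {I : Type} {pick : set I -> I}.
Hypotheses (hA0 : 1 <= A0) (hrho : quasi_metric A0 rho)
  (hdbl : geometrically_doubling rho) (hc0 : 0 < c0) (hC0 : c0 <= C0)
  (hdelta0 : 0 < delta) (hdelta1 : delta < 1)
  (hsmall : 12 * A0 ^+ 3 * C0 * delta <= c0)
  (pickP : forall S : set I, S !=set0 -> S (pick S)).
Context {A : int -> set I} {z : int -> I -> X}.
Hypothesis adm : admissible_points rho c0 C0 delta A z.

Local Notation nearest := (nearest rho pick A z).
Local Notation parent := (parent rho pick A z).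
Local Notation ancestor := (ancestor rho pick A z).
Local Notation limit_cube := (limit_cube rho delta pick A z).
Local Notation open_cube := (open_cube rho delta pick A z).
Local Notation address_up := (address_up rho delta k0 pick A z).
Local Notation address := (address rho delta k0 pick A z).
Local Notation half_open_cube := (half_open_cube rho delta k0 pick A z).

Let rhoxx := @qmetricxx R X rho A0 hrho.
Let rhoC := @qmetricC R X rho A0 hrho.
Let triangle := @qmetric_triangle R X rho A0 hrho.

Lemma scale_gt0 k : 0 < delta ^ k.
Proof. exact: exprz_gt0. Qed.

Lemma scale_succ k : delta ^ (k + 1) = delta ^ k * delta.
Proof. by rewrite expfzDr ?gt_eqF// expr1z. Qed.

Lemma scale_add k (n : nat) : delta ^ (k + n%:Z) = delta ^ k * delta ^+ n.
Proof. by rewrite expfzDr ?gt_eqF. Qed.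

Let A0_gt0 : 0 < A0. Proof. exact: lt_le_trans ltr01 hA0. Qed.
Let C0_gt0 : 0 < C0. Proof. exact: lt_le_trans hc0 hC0. Qed.

(** The comparisons between constants through which the smallness of [delta]
    enters, in a form suited to linear arithmetic. *)
Lemma constants_at_scale k :
  [/\ 12 * (A0 * (A0 * (A0 * (C0 * delta)))) * delta ^ k <= c0 * delta ^ k,
      12 * (A0 * (A0 * (C0 * delta))) * delta ^ k <= c0 * delta ^ k,
      C0 * delta ^ k <= A0 * C0 * delta ^ k,
      c0 * delta ^ k <= C0 * delta ^ k & 0 < c0 * delta ^ k].
Proof.
have small3 : 12 * (A0 * (A0 * (A0 * (C0 * delta)))) <= c0.
  by rewrite (_ : 12 * _ = 12 * A0 ^+ 3 * C0 * delta) //; ring.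
rewrite !ler_pM2r ?scale_gt0// mulr_gt0 ?scale_gt0//; split=> //.
  apply: le_trans small3; rewrite ler_pM2l// ler_peMl// !mulr_ge0//; exact: ltW.
by rewrite ler_peMl// ltW.
Qed.

Lemma nearestP k x : [/\ A k (nearest k x),
  forall b, A k b -> rho x (z k (nearest k x)) <= rho x (z k b) &
  rho x (z k (nearest k x)) < C0 * delta ^ k].
Proof.
have [_ /(_ k x)[a [Aa mina alt]]] := adm.
have [Ab minb] : [set a | A k a /\ forall b, A k b ->
    rho x (z k a) <= rho x (z k b)] (nearest k x).
  by apply: pickP; exists a.
by split=> //; apply: le_lt_trans (minb a Aa) alt.
Qed.

Lemma parent_in k b : A k (parent k b).
Proof. by have [] := nearestP k (z (k + 1) b). Qed.

Lemma parent_dist k b : rho (z (k + 1) b) (z k (parent k b)) < C0 * delta ^ k.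
Proof. by have [] := nearestP k (z (k + 1) b). Qed.

(** Two points of level [k] within [c0 / (2 * A0) * delta ^ k] of a third one
    are too close to each other to be distinct. *)
Lemma parent_unique k a b : A k a ->
  2 * A0 * rho (z (k + 1) b) (z k a) < c0 * delta ^ k -> parent k b = a.
Proof.
move=> Aa close; apply: contrapT => ne.
have := proj1 adm k _ _ (parent_in k b) Aa ne.
have [_ /(_ a Aa) + _] := nearestP k (z (k + 1) b); rewrite -/(parent k b).
have := triangle (z (k + 1) b) (z k (parent k b)) (z k a).
rewrite (rhoC _ (z (k + 1) b)) => h1 h2 h3.
have : A0 * (rho (z (k + 1) b) (z k (parent k b)) + rho (z (k + 1) b) (z k a))
  <= A0 * (2 * rho (z (k + 1) b) (z k a)) by rewrite ler_pM2l//; lra.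
lra.
Qed.

Lemma ancestor_in n k b : A (k + n%:Z) b -> A k (ancestor n k b).
Proof. by case: n => [|n] /=; [rewrite addr0|move=> _; exact: parent_in]. Qed.

Lemma ancestorD n m k b :
  ancestor (n + m) k b = ancestor n k (ancestor m (k + n%:Z) b).
Proof.
elim: n k => [|n IH] k /=; first by rewrite addr0.
by rewrite IH int_succA.
Qed.

(** Each generation multiplies the distance by [A0] but shrinks it by [delta],
    so the bounds sum like a geometric series. *)
Lemma ancestor_dist n k b :
  rho (z (k + n%:Z) b) (z k (ancestor n k b)) <= 2 * A0 * C0 * delta ^ k.
Proof.
elim: n k => [|n IH] k /=.
  by rewrite addr0 rhoxx !mulr_ge0// ltW// scale_gt0.
have d0 := scale_gt0 k.
have := IH (k + 1); rewrite -int_succA scale_succ; set c := ancestor _ _ _ => h1.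
have h2 := parent_dist k c.
have h3 := triangle (z (k + 1) c) (z (k + n.+1%:Z) b) (z k (parent k c)).
apply: (le_trans h3).
have : A0 * (rho (z (k + n.+1%:Z) b) (z (k + 1) c) +
   rho (z (k + 1) c) (z k (parent k c))) <=
   A0 * (2 * A0 * C0 * (delta ^ k * delta) + C0 * delta ^ k).
  by rewrite ler_pM2l//; lra.
move=> /le_trans; apply.
have [_ s2 s1 s0 s00] := constants_at_scale k.
lra.
Qed.

(** Routing through the child [c] of the ancestor, rather than applying
    [ancestor_dist] at once, puts the extra factors [A0] in front of the small
    term of scale [delta ^ (k + 1)]; a single [A0] remains at scale [delta ^ k]. *)
Lemma near_descendant_dist n k b x e :
  rho x (z (k + n.+1%:Z) b) < e ->
  rho x (z k (ancestor n.+1 k b)) <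
    A0 * (A0 * e) + 7 / 6 * (A0 * C0) * delta ^ k.
Proof.
move=> xe; have d0 := scale_gt0 k.
have := ancestor_dist n (k + 1) b.
rewrite -int_succA scale_succ /=; set c := ancestor _ _ _ => h1.
have h2 := parent_dist k c.
have h3 := triangle (z (k + n.+1%:Z) b) x (z (k + 1) c).
have h4 := triangle (z (k + 1) c) x (z k (parent k c)).
apply: (le_lt_trans h4).
have h5 : A0 * (rho x (z (k + n.+1%:Z) b) + rho (z (k + n.+1%:Z) b) (z (k + 1) c))
   < A0 * (e + 2 * A0 * C0 * (delta ^ k * delta)).
  by rewrite ltr_pM2l//; lra.
have : A0 * (rho x (z (k + 1) c) + rho (z (k + 1) c) (z k (parent k c))) <
   A0 * (A0 * (e + 2 * A0 * C0 * (delta ^ k * delta)) + C0 * delta ^ k).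
  by rewrite ltr_pM2l//; lra.
move=> /lt_le_trans; apply.
have [s3 _ s1 s0 s00] := constants_at_scale k.
lra.
Qed.

(** * Limit cubes *)

Lemma limit_cube_at k a x : limit_cube k a x -> forall N e, 0 < e ->
  exists n b, [/\ (N <= n)%N, A (k + n%:Z) b, ancestor n k b = a &
                  rho x (z (k + n%:Z) b) < e].
Proof.
move=> xa N e /(exprn_lt_eventually hdelta0 hdelta1)[M Me].
have [n [b [Nn Ab anb xb]]] := xa (maxn N M).
exists n, b; split => //; first exact: leq_trans (leq_maxl _ _) Nn.
exact: lt_trans xb (Me _ (leq_maxr _ _)).
Qed.

Lemma limit_cube_ancestor n k b x :
  limit_cube (k + n%:Z) b x -> limit_cube k (ancestor n k b) x.
Proof.
move=> xb N; have [m [c [Nm Ac <- xc]]] := xb N.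
exists (n + m)%N, c; rewrite ancestorD PoszD addrA; split=> //.
exact: leq_trans Nm (leq_addl _ _).
Qed.

(** By doubling, only finitely many ancestors of level [k] occur, so the
    pigeonhole principle selects one that serves all precisions. *)
Lemma limit_cube_accumulation k (T : set I) x :
  (forall N e, 0 < e -> exists n b, [/\ (N <= n)%N, A (k + n%:Z) b,
     T (ancestor n k b) & rho x (z (k + n%:Z) b) < e]) ->
  exists a, [/\ A k a, T a & limit_cube k a x].
Proof.
move=> acc; have d0 := scale_gt0 k.
(* level [k] ancestors of points within distance 1 of [x] are this close *)
pose r := A0 * (2 * A0 * C0 * delta ^ k + 1) + 1.
have finF : finite_set (A k `&` [set a | rho (z k a) x < r]).
  apply: (separated_ball_finite hA0 hrho hdbl (mulr_gt0 hc0 d0)).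
  by move=> a b Aa Ab ab; apply: (proj1 adm).
pose P a N := T a /\ exists n b, [/\ (N <= n)%N, A (k + n%:Z) b,
  ancestor n k b = a & rho x (z (k + n%:Z) b) < delta ^+ N].
have [a m n mn [Ta [i [b [ni Ab anb xb]]]]|N|] := finite_pigeonhole _ _ P finF.
- split=> //; exists i, b; split=> //; first exact: leq_trans ni.
  by apply: lt_le_trans xb _; rewrite ler_wiXn2l// ltW.
- have [n [b [Nn Ab Tb xb]]] := acc N _ (exprn_gt0 N hdelta0).
  exists (ancestor n k b); last by split=> //; exists n, b.
  split; first exact: ancestor_in.
  apply: le_lt_trans (triangle (z (k + n%:Z) b) _ _) _.
  rewrite (rhoC (z k _)) (rhoC _ x) /r ltr_pwDr// ler_pM2l// lerD//.
    exact: ancestor_dist.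
  by apply: le_trans (ltW xb) _; rewrite exprn_ile1// ltW.
- move=> a [Aa _] Pa; exists a; have [Ta _] := Pa 0%N.
  by split=> // N; have [] := Pa N.
Qed.

Lemma limit_cube_cover k x : exists a, A k a /\ limit_cube k a x.
Proof.
have [N e e0|a [Aa _ xa]] := limit_cube_accumulation k setT x; last by exists a.
have d0 := scale_gt0 k.
have [M Me] := exprn_lt_eventually hdelta0 hdelta1
  (divr_gt0 e0 (mulr_gt0 C0_gt0 d0)).
have [Ab _ xb] := nearestP (k + (maxn N M)%:Z) x.
exists (maxn N M), (nearest (k + (maxn N M)%:Z) x); split=> //.
  exact: leq_maxl.
apply: (lt_le_trans xb); rewrite scale_add mulrA mulrC -ler_pdivlMr ?mulr_gt0//.
exact: ltW (Me _ (leq_maxr _ _)).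
Qed.

Lemma limit_cube_child k a x : limit_cube k a x ->
  exists b, [/\ A (k + 1) b, parent k b = a & limit_cube (k + 1) b x].
Proof.
move=> xa; apply: limit_cube_accumulation => N e e0.
(* depth [N.+1] below [k] guarantees depth [N] below the child *)
have [[|n] [b [Nn Ab anb xb]]] := limit_cube_at _ _ _ xa N.+1 _ e0; first by [].
by exists n, b; rewrite -int_succA.
Qed.

Lemma limit_cube_sub_ball k a x : limit_cube k a x ->
  rho x (z k a) < 2 * A0 * C0 * delta ^ k.
Proof.
move=> xa; have d0 := scale_gt0 k.
(* with this [e], the error [A0 ^ 2 * e] is half of [A0 * C0 * delta ^ k] *)
pose e := C0 / (2 * A0) * delta ^ k.
have e0 : 0 < e by rewrite !mulr_gt0// invr_gt0 mulr_gt0.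
have [[|n] [b [Nn Ab <- xb]]] := limit_cube_at _ _ _ xa 1 e e0; first by [].
apply: lt_trans (near_descendant_dist _ _ _ _ _ xb) _.
have -> : A0 * (A0 * e) = A0 * C0 * delta ^ k / 2.
  by rewrite /e; field; rewrite gt_eqF.
have : 0 < A0 * C0 * delta ^ k by rewrite !mulr_gt0.
lra.
Qed.

(** If [x] is also in the limit cube of a child [c] of [b], then [z (k + 1) c]
    is so close to [x], hence to [z k a], that the parent of [c] must be [a]. *)
Lemma inner_ball_limit_cube k a b x : A k a ->
  rho x (z k a) < (3 * A0 ^+ 2)^-1 * c0 * delta ^ k ->
  limit_cube k b x -> b = a.
Proof.
move=> Aa xa /limit_cube_child[c [Ac <- xc]]; have d0 := scale_gt0 k.
apply: parent_unique => //.
have := limit_cube_sub_ball _ _ _ xc; rewrite scale_succ => {}xc.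
have h := triangle x (z (k + 1) c) (z k a).
rewrite (rhoC _ x) in h.
have {}xa : 3 * (A0 * (A0 * rho x (z k a))) < c0 * delta ^ k.
  move: xa; rewrite -mulrA mulrC ltr_pdivlMr ?mulr_gt0 ?exprn_gt0//.
  by apply: le_lt_trans; rewrite le_eqVlt; apply/orP; left; apply/eqP; ring.
have : 2 * A0 * rho (z (k + 1) c) (z k a) <=
    2 * A0 * (A0 * (rho x (z (k + 1) c) + rho x (z k a))).
  by rewrite ler_pM2l// mulr_gt0.
move=> /le_lt_trans; apply.
have : 2 * A0 * A0 * rho x (z (k + 1) c) <
   2 * A0 * A0 * (2 * A0 * C0 * (delta ^ k * delta)).
  by rewrite ltr_pM2l// !mulr_gt0.
have [s3 _ _ _ _] := constants_at_scale k.
lra.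
Qed.

Lemma limit_cube_closed k a : qopen rho (~` limit_cube k a).
Proof.
move=> x nxa; apply: contrapT => nball; apply: nxa => N.
have e0 : 0 < delta ^+ N / (2 * A0) by rewrite divr_gt0 ?exprn_gt0 ?mulr_gt0.
have [y [yx ya]] : exists y, rho y x < delta ^+ N / (2 * A0) /\ limit_cube k a y.
  apply: contrapT => none; apply: nball; exists (delta ^+ N / (2 * A0)) => //.
  by move=> y yx ya; apply: none; exists y.
have [n [b [Nn Ab anb yb]]] := limit_cube_at _ _ _ ya N _ e0.
exists n, b; split=> //.
apply: le_lt_trans (triangle y _ _) _; rewrite (rhoC x).
by move: yx yb; rewrite !ltr_pdivlMr ?mulr_gt0//; lra.
Qed.

(** A failure at [x] means that points of other limit cubes approach [x]; their
    descendants then accumulate at [x], which puts [x] itself in another limit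
    cube. *)
Lemma open_cube_open k a : qopen rho (open_cube k a).
Proof.
move=> x xa; apply: contrapT => nball.
have [|b [Ab ba xb]] := limit_cube_accumulation k [set b | b <> a] x; last first.
  by apply: ba; apply: xa.
move=> N e e0.
have e1 : 0 < e / (2 * A0) by rewrite divr_gt0 ?mulr_gt0.
have [y [yx [b [Ab ba yb]]]] : exists y, rho y x < e / (2 * A0) /\
    exists b, [/\ A k b, b <> a & limit_cube k b y].
  apply: contrapT => none; apply: nball; exists (e / (2 * A0)) => //.
  move=> y yx b Ab yb; apply: contrapT => ba; apply: none.
  by exists y; split=> //; exists b.
have [n [c [Nn Ac anc yc]]] := limit_cube_at _ _ _ yb N _ e1.
exists n, c; split=> //; first by rewrite /= anc.
apply: le_lt_trans (triangle y _ _) _; rewrite (rhoC x).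
by move: yx yc; rewrite !ltr_pdivlMr ?mulr_gt0//; lra.
Qed.

(** * Half-open cubes *)

Lemma address_upP n x : A (k0 + n%:Z) (address_up n x) /\
  limit_cube (k0 + n%:Z) (address_up n x) x.
Proof.
elim: n => [|n [IHA IHx]] /=.
  rewrite addr0; apply: (pickP [set a | A k0 a /\ limit_cube k0 a x]).
  exact: limit_cube_cover.
by rewrite int_succ; have [] := pickP _ (limit_cube_child _ _ _ IHx).
Qed.

Lemma parent_address_up n x :
  parent (k0 + n%:Z) (address_up n.+1 x) = address_up n x.
Proof.
have [_ IHx] := address_upP n x.
by have [] := pickP _ (limit_cube_child _ _ _ IHx).
Qed.

Lemma address_above n x : address (k0 + n%:Z) x = address_up n x.
Proof. by rewrite /address addrAC subrr add0r. Qed.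

Lemma address_below n x :
  address (k0 - n%:Z) x = ancestor n (k0 - n%:Z) (address_up 0 x).
Proof.
case: n => [|n].
  by rewrite subr0; have := address_above 0 x; rewrite addr0.
by rewrite {1}/address addrAC subrr add0r -NegzE.
Qed.

Lemma addressP k x : A k (address k x) /\ limit_cube k (address k x) x.
Proof.
have [[n ->]|[n ->]] := int_split k0 k.
  by rewrite address_above; exact: address_upP.
have [A1 x1] := address_upP 0 x; rewrite addr0 in A1 x1.
rewrite address_below; split.
  by apply: ancestor_in; rewrite subrK.
by apply: limit_cube_ancestor; rewrite subrK.
Qed.

Lemma parent_address k x : parent k (address (k + 1) x) = address k x.
Proof.
have [[n ->]|[n ->]] := int_split k0 k.
  by rewrite -int_succ !address_above parent_address_up.
rewrite (_ : k0 - _ + 1 = k0 - n%:Z); last by lia.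
by rewrite !address_below /= (_ : k0 - _ + 1 = k0 - n%:Z) //; lia.
Qed.

Lemma ancestor_address n k x : ancestor n k (address (k + n%:Z) x) = address k x.
Proof.
elim: n k => [|n IH] k /=; first by rewrite addr0.
by rewrite int_succA IH parent_address.
Qed.

Lemma half_open_cube_nested n k b :
  half_open_cube (k + n%:Z) b `<=` half_open_cube k (ancestor n k b).
Proof. by move=> x /= <-; rewrite ancestor_address. Qed.

Lemma half_open_cube_sub_limit k a : half_open_cube k a `<=` limit_cube k a.
Proof. by move=> x /= <-; have [] := addressP k x. Qed.

Lemma open_cube_sub_half_open k a : open_cube k a `<=` half_open_cube k a.
Proof. by move=> x xa; have [] := addressP k x; exact: xa. Qed.

Lemma inner_ball_sub_half_open k a : A k a ->
  qball rho (z k a) ((3 * A0 ^+ 2)^-1 * c0 * delta ^ k) `<=` half_open_cube k a.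
Proof.
move=> Aa x xa; apply: (inner_ball_limit_cube k a _ x Aa xa).
by have [] := addressP k x.
Qed.

Lemma center_in_half_open k a : A k a -> half_open_cube k a (z k a).
Proof.
move=> Aa; apply: inner_ball_sub_half_open => //.
by rewrite /qball /= rhoxx !mulr_gt0 ?scale_gt0 ?invr_gt0 ?mulr_gt0 ?exprn_gt0.
Qed.

Lemma half_open_cube_sub_ball k a :
  half_open_cube k a `<=` qball rho (z k a) (2 * A0 * C0 * delta ^ k).
Proof. by move=> x /half_open_cube_sub_limit/limit_cube_sub_ball. Qed.

(** The approximating points of a limit cube are centres of smaller half-open
    cubes, hence lie in the half-open cube itself. *)
Lemma half_open_cube_dense k a x e : limit_cube k a x -> 0 < e ->
  half_open_cube k a `&` qball rho x e !=set0.
Proof.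
move=> xa e0; have [n [b [_ Ab <- xb]]] := limit_cube_at _ _ _ xa 0 _ e0.
exists (z (k + n%:Z) b); split; last by rewrite /qball /= rhoC.
exact/half_open_cube_nested/center_in_half_open.
Qed.

(** An open set inside the half-open cube of [a] cannot meet the limit cube of
    another [b], since the half-open cube of [b], disjoint from that of [a], is
    dense there. *)
Lemma open_cube_interior k a : open_cube k a = qinterior rho (half_open_cube k a).
Proof.
apply: qinterior_unique; first exact: open_cube_open.
  exact: open_cube_sub_half_open.
move=> W oW WQ x Wx b Ab xb; have [e e0 eW] := oW x Wx.
have [y [yb ye]] := half_open_cube_dense _ _ _ _ xb e0.
by rewrite -yb; exact: WQ (eW _ ye).
Qed.

Lemma limit_cube_closure k a : limit_cube k a = qclosure rho (half_open_cube k a).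
Proof.
apply: qclosure_unique; first exact: limit_cube_closed.
  exact: half_open_cube_sub_limit.
by move=> x xa e e0; exact: half_open_cube_dense.
Qed.

Lemma half_open_cube_cover k : setT = \bigcup_(a in A k) half_open_cube k a.
Proof.
rewrite eqEsubset; split=> // x _; exists (address k x) => //.
by have [] := addressP k x.
Qed.

Lemma half_open_cube_disjoint k : trivIset (A k) (half_open_cube k).
Proof. by move=> a b _ _ [x [/= <- <-]]. Qed.

Lemma half_open_cube_dichotomy k l a b : k <= l ->
  half_open_cube l b `<=` half_open_cube k a \/
  half_open_cube k a `&` half_open_cube l b = set0.
Proof.
move=> kl; have [n ->] : exists n : nat, l = k + n%:Z by exists `|l - k|%N; lia.
have [<-|ne] := pselect (ancestor n k b = a).
  by left; exact: half_open_cube_nested.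
right; rewrite -subset0 => x [/= xa xb]; apply: ne.
by rewrite -xa -xb ancestor_address.
Qed.

Lemma outer_ball_nested k l a b : k <= l -> A l b ->
  half_open_cube l b `<=` half_open_cube k a ->
  qball rho (z l b) (2 * A0 * C0 * delta ^ l) `<=`
  qball rho (z k a) (2 * A0 * C0 * delta ^ k).
Proof.
move=> kl; have [n ->] : exists n : nat, l = k + n%:Z by exists `|l - k|%N; lia.
move=> Ab /(_ _ (center_in_half_open _ _ Ab)).
move: (half_open_cube_nested n k _ _ (center_in_half_open _ _ Ab)).
rewrite /half_open_cube /= => -> <- {a}.
case: n Ab => [|n] Ab; first by rewrite addr0.
move=> x xb; apply: lt_le_trans (near_descendant_dist _ _ _ _ _ xb) _.
have d0 := scale_gt0 k; rewrite scale_add exprS.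
set p := delta ^+ n.
have p1 : A0 * (A0 * (A0 * (C0 * delta))) * delta ^ k * p <=
    A0 * (A0 * (A0 * (C0 * delta))) * delta ^ k.
  by rewrite ler_piMr ?exprn_ile1 ?mulr_ge0// ltW.
have [s3 _ s1 s0 s00] := constants_at_scale k.
lra.
Qed.

End cubes_of_one_family.

(** * Dependence on the points *)

Section dependence.
Context {R : realType} {X : Type} {rho : X -> X -> R} {A0 c0 C0 delta : R}
  {k0 : int} {I : Type} {pick : set I -> I}.
Hypotheses (hA0 : 1 <= A0) (hrho : quasi_metric A0 rho)
  (hdbl : geometrically_doubling rho) (hc0 : 0 < c0) (hC0 : c0 <= C0)
  (hdelta0 : 0 < delta) (hdelta1 : delta < 1)
  (hsmall : 12 * A0 ^+ 3 * C0 * delta <= c0)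
  (pickP : forall S : set I, S !=set0 -> S (pick S)).

Lemma same_points_from_sym (m : int) (A A' : int -> set I)
  (z z' : int -> I -> X) :
  same_points_from m A A' z z' -> same_points_from m A' A z' z.
Proof.
move=> same l ml; have [AA zz] := same l ml.
by split=> // a A'a; rewrite zz // AA.
Qed.

Lemma same_points_from_le (m m' : int) (A A' : int -> set I)
  (z z' : int -> I -> X) : m <= m' ->
  same_points_from m A A' z z' -> same_points_from m' A A' z z'.
Proof. by move=> mm same l ml; apply: same; apply: le_trans ml. Qed.

Section two_families.
Context {A A' : int -> set I} {z z' : int -> I -> X}.
Hypotheses (adm : admissible_points rho c0 C0 delta A z)
  (adm' : admissible_points rho c0 C0 delta A' z').

Lemma nearest_local k x : same_points_from k A A' z z' ->
  nearest rho pick A z k x = nearest rho pick A' z' k x.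
Proof.
move=> /(_ k (lexx _))[AA zz]; rewrite /nearest -AA; congr pick.
rewrite eqEsubset; split=> a /= [Aa mina]; split=> // b Ab.
  by rewrite -!zz//; exact: mina.
by rewrite !zz//; exact: mina.
Qed.

Lemma ancestor_local n k b : same_points_from k A A' z z' -> A (k + n%:Z) b ->
  ancestor rho pick A z n k b = ancestor rho pick A' z' n k b.
Proof.
elim: n k => [//|n IH] k same Ab /=.
have kk1 : k <= k + 1 := int_le_add k 1.
have same1 := same_points_from_le _ _ _ _ _ _ kk1 same.
rewrite -IH -?int_succA// /parent (nearest_local _ _ same).
have [_ ->//] := same _ kk1.
by apply: (ancestor_in pickP adm); rewrite -int_succA.
Qed.
End two_families.

Lemma limit_cube_local {A A' : int -> set I} {z z' : int -> I -> X} k a :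
  admissible_points rho c0 C0 delta A z ->
  admissible_points rho c0 C0 delta A' z' ->
  same_points_from k A A' z z' ->
  limit_cube rho delta pick A z k a = limit_cube rho delta pick A' z' k a.
Proof.
move=> adm adm' same; rewrite eqEsubset; split=> x xa N.
  have [n [b [Nn Ab <- xb]]] := xa N; exists n, b.
  have kn := int_le_add k n.
  have [AA zz] := same _ kn.
  by rewrite -AA -(ancestor_local adm) -?zz.
have same' := same_points_from_sym _ _ _ _ _ same.
have [n [b [Nn Ab <- xb]]] := xa N; exists n, b.
have kn := int_le_add k n.
have [AA zz] := same' _ kn.
by rewrite -AA -(ancestor_local adm') -?zz.
Qed.

Context {A A' : int -> set I} {z z' : int -> I -> X}.
Hypotheses (adm : admissible_points rho c0 C0 delta A z)
  (adm' : admissible_points rho c0 C0 delta A' z').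

Lemma open_cube_local k a : same_points_from k A A' z z' ->
  open_cube rho delta pick A z k a = open_cube rho delta pick A' z' k a.
Proof.
move=> same; rewrite /open_cube; have [-> _] := same k (lexx _).
apply/funext => x; apply/propext.
by split=> h b Ab; have := h b Ab; rewrite (limit_cube_local k b adm adm' same).
Qed.

Lemma address_up_local n x : same_points_from k0 A A' z z' ->
  address_up rho delta k0 pick A z n x = address_up rho delta k0 pick A' z' n x.
Proof.
move=> same; elim: n => [|n IH] /=.
  have [-> _] := same _ (lexx _); congr pick.
  by apply/funext => a; rewrite /= (limit_cube_local k0 a adm adm' same).
have k0n := int_le_add k0 n.
have := int_le_add k0 n.+1; rewrite int_succ => k0n1.
have samen := same_points_from_le _ _ _ _ _ _ k0n same.
have samen1 := same_points_from_le _ _ _ _ _ _ k0n1 same.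
have [AA zz] := same _ k0n1.
congr pick; rewrite eqEsubset.
split=> b /= [Ab pb xb]; split.
- by rewrite -AA.
- by rewrite -IH -pb /parent -(nearest_local _ _ samen) -zz.
- by rewrite -(limit_cube_local _ _ adm adm' samen1).
- by rewrite AA.
- by rewrite IH -pb /parent (nearest_local _ _ samen) zz// AA.
- by rewrite (limit_cube_local _ _ adm adm' samen1).
Qed.

(** Below level [k0] the address descends from the level [k0] choice, above
    it is built upwards from that choice; only levels from [min k k0] on occur. *)
Lemma half_open_cube_local k a : same_points_from (Num.min k k0) A A' z z' ->
  half_open_cube rho delta k0 pick A z k a =
  half_open_cube rho delta k0 pick A' z' k a.
Proof.
move=> same; have le_k : Num.min k k0 <= k by rewrite ge_min lexx.
have le_k0 : Num.min k k0 <= k0 by rewrite ge_min lexx orbT.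
have samek := same_points_from_le _ _ _ _ _ _ le_k same.
have samek0 := same_points_from_le _ _ _ _ _ _ le_k0 same.
suff addressE x : address rho delta k0 pick A z k x =
    address rho delta k0 pick A' z' k x.
  by apply/funext => x; rewrite /half_open_cube /= addressE.
rewrite /address; case E : (k - k0) => [n|n]; first exact: address_up_local.
rewrite -(address_up_local 0 x samek0); apply: ancestor_local => //.
rewrite (_ : k + n.+1%:Z = k0); last by lia.
have := address_upP hA0 hrho hdbl hc0 hC0 hdelta0 hdelta1 hsmall pickP adm
  (k0 := k0) 0 x.
by rewrite addr0 => -[].
Qed.

End dependence.

Theorem theorem2p2 (R : realType) (X : Type) (rho : X -> X -> R)
    (A0 c0 C0 delta : R) (k0 : int) (I : Type)
    (hA0 : 1 <= A0) (hrho : quasi_metric A0 rho)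
    (hdoubling : geometrically_doubling rho)
    (hc0 : 0 < c0) (hC0 : c0 <= C0) (hdelta0 : 0 < delta) (hdelta1 : delta < 1)
    (hsmall : 12 * A0 ^+ 3 * C0 * delta <= c0) :
  let c1 := (3 * A0 ^+ 2)^-1 * c0 in
  let C1 := 2 * A0 * C0 in
  exists Qopen Q Qclosed :
      (int -> set I) -> (int -> I -> X) -> int -> I -> set X,
    (forall (A : int -> set I) (z : int -> I -> X),
       admissible_points rho c0 C0 delta A z ->
       let BQ (k : int) (a : I) := qball rho (z k a) (C1 * delta ^ k) in
       (forall k a, A k a ->
          Qopen A z k a `<=` Q A z k a /\ Q A z k a `<=` Qclosed A z k a) /\
       [/\ (forall k a, A k a ->
              Qopen A z k a = qinterior rho (Q A z k a) /\
              Qclosed A z k a = qclosure rho (Q A z k a)),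
           (forall k l a b, k <= l -> A k a -> A l b ->
              Q A z l b `<=` Q A z k a \/ Q A z k a `&` Q A z l b = set0),
           (forall k, setT = \bigcup_(a in A k) Q A z k a /\
              trivIset (A k) (Q A z k)),
           (forall k a, A k a ->
              qball rho (z k a) (c1 * delta ^ k) `<=` Q A z k a /\
              Q A z k a `<=` BQ k a) &
           (forall k l a b, k <= l -> A k a -> A l b ->
              Q A z l b `<=` Q A z k a -> BQ l b `<=` BQ k a)]) /\
    (forall (A A' : int -> set I) (z z' : int -> I -> X),
       admissible_points rho c0 C0 delta A z ->
       admissible_points rho c0 C0 delta A' z' ->
       forall k,
         (same_points_from k A A' z z' ->
            forall a, A k a ->
              Qopen A z k a = Qopen A' z' k a /\
              Qclosed A z k a = Qclosed A' z' k a) /\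
         (same_points_from (Num.min k k0) A A' z z' ->
            forall a, A k a -> Q A z k a = Q A' z' k a)).
Proof.
(* without indices there are no points, and a choice function may not exist *)
have [i0|noI] := pselect (inhabited I); last first.
  exists (fun _ _ _ _ => set0), (fun _ _ _ _ => set0), (fun _ _ _ _ => set0).
  split=> [A z [_ cover]|A A' z z' _ _ k]; last by split.
  have noX (x : X) : False.
    by have [a _] := cover 0 x; apply: noI; exists.
  have set_eq (U V : set X) : U = V.
    by rewrite eqEsubset; split=> x; case: (noX x).
  split=> [k a|]; first by split.
  split=> [k a|k l a b|k|k a|k l a b] *.
  - by split; exact: set_eq.
  - by left.
  - by split; [exact: set_eq|move=> a b _ _ [x]; case: (noX x)].
  - by split=> x; case: (noX x).
  - by move=> x; case: (noX x).
have [pick pickP] : exists pick : set I -> I,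
    forall S, S !=set0 -> S (pick S).
  have /choice[pick pickP] : forall S : set I, exists a, S !=set0 -> S a.
    move=> S; have [[a Sa]|S0] := pselect (S !=set0); first by exists a.
    by case: i0 => a; exists a => /S0.
  by exists pick.
exists (open_cube rho delta pick), (half_open_cube rho delta k0 pick),
  (limit_cube rho delta pick); split=> [A z adm BQ|A A' z z' adm adm' k].
  split=> [k a Aa|].
    have sub1 := open_cube_sub_half_open hA0 hrho hdoubling hc0 hC0
      hdelta0 hdelta1 hsmall pickP adm (k0 := k0) k a.
    have sub2 := half_open_cube_sub_limit hA0 hrho hdoubling hc0 hC0
      hdelta0 hdelta1 hsmall pickP adm (k0 := k0) k a.
    by split.
  split=> [k a Aa|k l a b kl _ _|k|k a Aa|k l a b kl _ Ab].
  - by split; [exact: (open_cube_interior hA0 hrho hdoubling hc0 hC0)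
              |exact: (limit_cube_closure hA0 hrho hdoubling hc0 hC0)].
  - exact: (half_open_cube_dichotomy hA0 hrho hdoubling hc0 hC0).
  - by split; [exact: (half_open_cube_cover hA0 hrho hdoubling hc0 hC0)
              |exact: half_open_cube_disjoint].
  - by split; [exact: (inner_ball_sub_half_open hA0 hrho hdoubling hc0 hC0)
              |exact: (half_open_cube_sub_ball hA0 hrho hdoubling hc0 hC0)].
  - exact: (outer_ball_nested hA0 hrho hdoubling hc0 hC0).
split=> [same a _|same a _]; last first.
  exact: (half_open_cube_local hA0 hrho hdoubling hc0 hC0).
by split; [exact: (open_cube_local pickP adm adm')
          |exact: (limit_cube_local pickP _ _ adm adm')].
Qed.
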